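(* Let $\mathcal{H}_1,\mathcal{H}_2$ be right quaternionic Hilbert spaces, $K_1 \in \mathbb{B}(\mathcal{H}_1)$ and $K_2 \in \mathbb{B}(\mathcal{H}_2)$. If a sequence $\{ u_i \oplus v_i \}_{i \in I}$ in $\mathcal{H}_1 \oplus \mathcal{H}_2$ is a $K_1 \oplus K_2$-frame for $\mathcal{H}_1 \oplus \mathcal{H}_2$, then $\{ u_i \}_{i \in I}$ is a $K_1$-frame for $\mathcal{H}_1$ and $\{ v_i \}_{i \in I}$ is a $K_2$-frame for $\mathcal{H}_2$.
   Context: $\mathbb{H}$ denotes the skew field of quaternions. A right quaternionic Hilbert space is a right $\mathbb{H}$-vector space with an inner product $\langle\cdot,\cdot\rangle$ valued in $\mathbb{H}$ satisfying $\langle u,v\rangle=\overline{\langle v,u\rangle}$, $\langle u,u\rangle>0$ for $u\neq 0$, additivity in the second variable and $\langle u,vq\rangle=\langle u,v\rangle q$ for $q\in\mathbb{H}$, complete for the norm $\|u\|=\sqrt{\langle u,u\rangle}$. $\mathbb{B}(\mathcal{H})$ is the set of bounded right $\mathbb{H}$-linear operators on $\mathcal{H}$; $L^*$ is the adjoint of $L$. $I$ is a countable index set. The direct sum $\mathcal{H}_1\oplus\mathcal{H}_2$ carries the inner product $\langle u_1\oplus v_1,u_2\oplus v_2\rangle=\langle u_1,u_2\rangle+\langle v_1,v_2\rangle$ and is a right quaternionic Hilbert space. $K_1\oplus K_2$ is the operator $(K_1\oplus K_2)(u\oplus v)=K_1u\oplus K_2v$. For $K\in\mathbb{B}(\mathcal{H})$,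 a sequence $\{w_i\}_{i\in I}$ in $\mathcal{H}$ is a $K$-frame for $\mathcal{H}$ if there are $0<A\le B<\infty$ with $A\|K^*u\|^2\le\sum_{i\in I}|\langle w_i,u\rangle|^2\le B\|u\|^2$ for all $u\in\mathcal{H}$. *)

(* Defs.v *)
From HB Require Import structures.
From mathcomp Require Import all_boot all_order all_algebra.
From mathcomp Require Import all_classical all_reals all_analysis.
From mathcomp Require Import ring lra.

Set Implicit Arguments.
Unset Strict Implicit.
Unset Printing Implicit Defensive.

Import Order.TTheory GRing.Theory Num.Theory.
Import numFieldNormedType.Exports.

Local Open Scope classical_set_scope.
Local Open Scope ring_scope.

(* Quat a b c d stands for a + b i + c j + d k. *)
Record quat (R : Type) := Quat { qre : R; qi : R; qj : R; qk : R }.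

Section QuaternionRing.
Variable R : realType.
Local Notation H := (quat R).

Definition tuple_of_quat (q : H) : R * R * R * R :=
  (qre q, qi q, qj q, qk q).
Definition quat_of_tuple (t : R * R * R * R) : H :=
  let: (a, b, c, d) := t in Quat a b c d.

Lemma tuple_of_quatK : cancel tuple_of_quat quat_of_tuple.
Proof. by case. Qed.

HB.instance Definition _ := Equality.copy H (can_type tuple_of_quatK).
HB.instance Definition _ := Choice.copy H (can_type tuple_of_quatK).

Definition qadd (x y : H) : H :=
  Quat (qre x + qre y) (qi x + qi y) (qj x + qj y) (qk x + qk y).
Definition qopp (x : H) : H := Quat (- qre x) (- qi x) (- qj x) (- qk x).
Definition qmul (x y : H) : H :=
  Quat (qre x * qre y - qi x * qi y - qj x * qj y - qk x * qk y)
       (qre x * qi y + qi x * qre y + qj x * qk y - qk x * qj y)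
       (qre x * qj y - qi x * qk y + qj x * qre y + qk x * qi y)
       (qre x * qk y + qi x * qj y - qj x * qi y + qk x * qre y).
Definition qzero : H := Quat 0 0 0 0.
Definition qone : H := Quat 1 0 0 0.

Fact qaddA : associative qadd.
Proof. by case=> ? ? ? ? [? ? ? ?] [? ? ? ?]; congr Quat => /=; ring. Qed.
Fact qaddC : commutative qadd.
Proof. by case=> ? ? ? ? [? ? ? ?]; congr Quat => /=; ring. Qed.
Fact qadd0 : left_id qzero qadd.
Proof. by case=> ? ? ? ?; congr Quat => /=; ring. Qed.
Fact qaddN : left_inverse qzero qopp qadd.
Proof. by case=> ? ? ? ?; congr Quat => /=; ring. Qed.

HB.instance Definition _ := GRing.isZmodule.Build H qaddA qaddC qadd0 qaddN.

Fact qmulA : associative qmul.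
Proof. by case=> ? ? ? ? [? ? ? ?] [? ? ? ?]; congr Quat => /=; ring. Qed.
Fact qmul1 : left_id qone qmul.
Proof. by case=> ? ? ? ?; congr Quat => /=; ring. Qed.
Fact qmulr1 : right_id qone qmul.
Proof. by case=> ? ? ? ?; congr Quat => /=; ring. Qed.
Fact qmulDl : left_distributive qmul qadd.
Proof. by case=> ? ? ? ? [? ? ? ?] [? ? ? ?]; congr Quat => /=; ring. Qed.
Fact qmulDr : right_distributive qmul qadd.
Proof. by case=> ? ? ? ? [? ? ? ?] [? ? ? ?]; congr Quat => /=; ring. Qed.
Fact qone_neq0 : qone != qzero.
Proof. by apply/eqP => -[] /eqP; rewrite oner_eq0. Qed.

HB.instance Definition _ :=
  GRing.Zmodule_isNzRing.Build H qmulA qmul1 qmulr1 qmulDl qmulDr qone_neq0.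

Definition qconj (q : H) : H := Quat (qre q) (- qi q) (- qj q) (- qk q).

Definition qabs (q : H) : R :=
  Num.sqrt (qre q ^+ 2 + qi q ^+ 2 + qj q ^+ 2 + qk q ^+ 2).

Definition qreal (t : R) : H := Quat t 0 0 0.

(* The order of the reals, extended to H: q > 0 means that q is real and
   positive. *)
Definition qpos (q : H) : Prop := q = qreal (qre q) /\ 0 < qre q.

Lemma qreD (x y : H) : qre (x + y) = qre x + qre y. Proof. by []. Qed.
Lemma qre_conj (x : H) : qre (qconj x) = qre x. Proof. by []. Qed.
Lemma qconjD (x y : H) : qconj (x + y) = qconj x + qconj y.
Proof. by case: x y => ? ? ? ? [? ? ? ?]; congr Quat => /=; ring. Qed.
Lemma qconjM (x y : H) : qconj (x * y) = qconj y * qconj x.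
Proof. by case: x y => ? ? ? ? [? ? ? ?]; congr Quat => /=; ring. Qed.
Lemma qconjK : involutive qconj.
Proof. by case=> ? ? ? ?; congr Quat => /=; ring. Qed.
Lemma qreMr (x : H) t : qre (x * qreal t) = qre x * t.
Proof. by case: x => ? ? ? ? /=; ring. Qed.

Lemma qre_eq0 (d : H) : (forall q, qre (d * q) = 0) -> d = 0.
Proof.
case: d => a b c e h.
have := h (Quat 1 0 0 0); have := h (Quat 0 1 0 0).
have := h (Quat 0 0 1 0); have := h (Quat 0 0 0 1) => /= h1 h2 h3 h4.
by congr Quat; lra.
Qed.

End QuaternionRing.

(* Right H-vector spaces are left modules over the converse ring H^c;
   v *> q is the right action of q on v. *)
Definition rscale (R : realType) (V : lmodType (quat R)^c) (v : V) (q : quat R)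
  : V := (q : (quat R)^c) *: v.
Notation "v *> q" := (rscale v q) (at level 40, left associativity)
  : ring_scope.

HB.mixin Record isQuatInner (R : realType) V of GRing.Lmodule (quat R)^c V := {
  inner : V -> V -> quat R;
  inner_conj : forall u v, inner u v = qconj (inner v u);
  inner_gt0 : forall u, u != 0 -> qpos (inner u u);
  innerDr : forall u v w, inner u (v + w) = inner u v + inner u w;
  innerZr : forall u v (q : quat R), inner u (v *> q) = inner u v * q
}.

#[short(type="qprehilbertType")]
HB.structure Definition QuatPreHilbert (R : realType) :=
  {V of GRing.Lmodule (quat R)^c V & isQuatInner R V}.

Definition hnorm (R : realType) (V : qprehilbertType R) (u : V) : R :=
  Num.sqrt (qre (inner u u)).

HB.mixin Record isQuatComplete (R : realType) V of QuatPreHilbert R V := {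
  hcomplete : forall x : nat -> V,
    (forall e : R, 0 < e -> exists N : nat, forall m n : nat,
       (N <= m)%N -> (N <= n)%N -> hnorm (x m - x n) < e) ->
    exists l : V, hnorm (x n - l) @[n --> \oo] --> (0 : R)
}.

#[short(type="qhilbertType")]
HB.structure Definition QuatHilbert (R : realType) :=
  {V of QuatPreHilbert R V & isQuatComplete R V}.

Section InnerTheory.
Variables (R : realType) (V : qprehilbertType R).
Implicit Types u v w : V.

Definition rip u v : R := qre (inner u v).

Lemma innerDl u v w : inner (u + v) w = inner u w + inner v w.
Proof. by rewrite inner_conj innerDr qconjD -!inner_conj. Qed.

Lemma ripC u v : rip u v = rip v u.
Proof. by rewrite /rip inner_conj qre_conj. Qed.
Lemma ripDr u v w : rip u (v + w) = rip u v + rip u w.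
Proof. by rewrite /rip innerDr. Qed.
Lemma ripDl u v w : rip (u + v) w = rip u w + rip v w.
Proof. by rewrite !(ripC _ w) ripDr. Qed.
Lemma ripZr u v t : rip u (v *> qreal t) = rip u v * t.
Proof. by rewrite /rip innerZr qreMr. Qed.
Lemma ripZl u v t : rip (u *> qreal t) v = rip u v * t.
Proof. by rewrite ripC ripZr ripC. Qed.
Lemma rip0r u : rip u 0 = 0.
Proof. by have := ripDr u 0 0; rewrite addr0; lra. Qed.
Lemma ripNr u v : rip u (- v) = - rip u v.
Proof. by have := ripDr u v (- v); rewrite subrr rip0r; lra. Qed.
Lemma ripNl u v : rip (- u) v = - rip u v.
Proof. by rewrite ripC ripNr ripC. Qed.

Lemma rip_gt0 u : u != 0 -> 0 < rip u u.
Proof. by move/inner_gt0 => -[]. Qed.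
Lemma rip_ge0 u : 0 <= rip u u.
Proof.
by have [->|/rip_gt0/ltW//] := eqVneq u 0; rewrite rip0r.
Qed.

Lemma hnorm_sqr u : hnorm u ^+ 2 = rip u u.
Proof. by rewrite sqr_sqrtr // rip_ge0. Qed.
Lemma hnorm_ge0 u : 0 <= hnorm u.
Proof. exact: sqrtr_ge0. Qed.

Lemma ripN u : rip (- u) (- u) = rip u u.
Proof. by rewrite ripNl ripNr opprK. Qed.
Lemma hnormN u : hnorm (- u) = hnorm u.
Proof. by congr Num.sqrt; apply: ripN. Qed.

Lemma rip_le_hnorm u v : `|rip u v| <= hnorm u * hnorm v.
Proof.
rewrite -(@ler_pXn2r _ 2) ?nnegrE ?mulr_ge0 ?hnorm_ge0 ?normr_ge0 //.
rewrite real_normK ?num_real // exprMn !hnorm_sqr.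
have [->|/rip_gt0 v0] := eqVneq v 0; first by rewrite !rip0r expr0n mulr0.
set a := rip u v; set c := rip v v in v0 *; set b := rip u u.
have := rip_ge0 (u *> qreal c - v *> qreal a).
rewrite !(ripDl, ripDr, ripNl, ripNr, ripZl, ripZr) (ripC v u).
rewrite -/a -/b -/c => h.
have {h} : 0 <= c * (b * c - a ^+ 2).
  by apply: le_trans h _; rewrite le_eqVlt; apply/orP; left; apply/eqP; ring.
by rewrite pmulr_rge0 // subr_ge0.
Qed.

Lemma inner_inj u v : (forall w, inner u w = inner v w) -> u = v.
Proof.
move=> h; apply/eqP; rewrite -subr_eq0; apply/negPn/negP => /rip_gt0.
rewrite ripDl ripNl /rip h subrr ltxx //.
Qed.

End InnerTheory.

(* The set B(V); linearity over the converse ring is right H-linearity. *)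
Record bop (R : realType) (V : qprehilbertType R) := BOp {
  bop_fun :> {linear V -> V};
  bop_bounded : exists M : R, forall u, hnorm (bop_fun u) <= M * hnorm u
}.

Section Adjoint.
Variables (R : realType) (V : qhilbertType R).

(* Riesz representation, by minimizing |u|^2 - 2 g u. *)
Lemma real_riesz (g : V -> R) (C : R) :
  (forall u v, g (u + v) = g u + g v) ->
  (forall u t, g (u *> qreal t) = g u * t) ->
  (forall u, `|g u| <= C * hnorm u) ->
  exists w, forall h, g h = rip w h.
Proof.
move=> gD gZ gC.
pose J u := rip u u - 2 * g u.
pose E := [set J u | u in setT].
have lbE : lbound E (- C ^+ 2).
  move=> _ [u _ <-]; rewrite /J -hnorm_sqr.
  have := gC u; rewrite ler_norml => /andP[_ h].
  by have := sqr_ge0 (hnorm u - C); lra.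
have infE : has_inf E.
  by split; [exists (J 0), 0 | exists (- C ^+ 2)].
pose m := inf E.
have mJ u : m <= J u.
  by apply: ge_inf; [exists (- C ^+ 2) | exists u].
have d0 n : 0 < n.+1%:R^-1 :> R by rewrite invr_gt0 ltr0n.
have /choice[x xP] : forall n : nat, exists u, J u < m + n.+1%:R^-1.
  move=> n; have [_ [u _ <-] hu] := inf_adherent (d0 n) infE.
  by exists u.
have small (e : R) : 0 < e -> exists N, forall n, (N <= n)%N -> n.+1%:R^-1 < e.
  move=> e0; have := @near_infty_natSinv_lt R (PosNum e0).
  by case=> N _ hN; exists N => n /hN.
have par u v : rip (u - v) (u - v) <= 2 * J u + 2 * J v - 4 * m.
  have := mJ ((u + v) *> qreal 2^-1).
  rewrite /J gZ gD !(ripDl, ripDr, ripNl, ripNr, ripZl, ripZr) (ripC v u).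
  lra.
have [|w wP] := @hcomplete R V x.
  move=> e e0; have e20 : 0 < e ^+ 2 / 4 by rewrite divr_gt0 ?exprn_gt0.
  have [N hN] := small _ e20; exists N => p q Np Nq.
  rewrite -(@ltr_pXn2r _ 2) ?nnegrE ?hnorm_ge0 ?ltW // hnorm_sqr.
  apply: le_lt_trans (par _ _) _.
  move: (J (x p)) (xP p) (J (x q)) (xP q) => a ha b hb.
  move: (p.+1%:R^-1) (hN _ Np) ha (q.+1%:R^-1) (hN _ Nq) hb => *; lra.
exists w => h; apply/eqP; rewrite -subr_eq0 -normr_le0.
apply/ler_addgt0Pl => e e0; rewrite addr0.
pose c := hnorm h + 1.
have c0 : 0 < c by rewrite ltr_wpDl ?hnorm_ge0.
have ec0 : 0 < e / 2 / c by rewrite !divr_gt0.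
have [N1 hN1] : exists N, forall n, (N <= n)%N -> hnorm (x n - w) < e / 2 / c.
  move/cvgrPdist_lt : wP => /(_ _ ec0)[N _ hN]; exists N => n /hN.
  by rewrite sub0r normrN ger0_norm ?hnorm_ge0.
have [N2 hN2] := small ((e / 2 / c) ^+ 2) (exprn_gt0 _ ec0).
pose n := maxn N1 N2.
have {hN1} h1 := hN1 n (leq_maxl _ _); have {hN2} h2 := hN2 n (leq_maxr _ _).
pose a := rip (x n) h - g h.
have ha t : 0 <= n.+1%:R^-1 + 2 * t * a + t ^+ 2 * rip h h.
  have := mJ (x n + h *> qreal t).
  have -> : J (x n + h *> qreal t) = J (x n) + 2 * t * a + t ^+ 2 * rip h h.
    by rewrite /J gD gZ !(ripDl, ripDr, ripZl, ripZr) (ripC h) /a; ring.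
  move: (2 * t * a) (t ^+ 2 * rip h h) => y z.
  move: (J (x n)) (xP n) => b; move: (n.+1%:R^-1) => d; lra.
have ha2 : `|a| <= e / 2.
  have hh : rip h h <= c ^+ 2.
    by rewrite -hnorm_sqr /c; have := hnorm_ge0 h; nra.
  have : a ^+ 2 <= n.+1%:R^-1 * c ^+ 2.
    have := ha (- a / c ^+ 2).
    have c20 : 0 < c ^+ 2 by rewrite exprn_gt0.
    set z := n.+1%:R^-1 => h3.
    have h4 : (- a / c ^+ 2) ^+ 2 * rip h h <= (- a / c ^+ 2) ^+ 2 * c ^+ 2.
      by rewrite ler_wpM2l // sqr_ge0.
    have {}h3 : 0 <= z + 2 * (- a / c ^+ 2) * a + (- a / c ^+ 2) ^+ 2 * c ^+ 2.
      by apply: le_trans h3 _; rewrite lerD2l.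
    have eqz : z + 2 * (- a / c ^+ 2) * a + (- a / c ^+ 2) ^+ 2 * c ^+ 2 =
       z - a ^+ 2 / c ^+ 2 by field; rewrite gt_eqF.
    by move: h3; rewrite eqz subr_ge0 ler_pdivrMr.
  move=> h5; rewrite -(@ler_pXn2r _ 2) ?nnegrE ?normr_ge0 //; last lra.
  rewrite real_normK ?num_real //; apply: le_trans h5 _.
  rewrite -ler_pdivlMr ?exprn_gt0 // -expr_div_n; exact: ltW.
have -> : g h - rip w h = rip (x n - w) h - a by rewrite /a ripDl ripNl; ring.
apply: le_trans (ler_normB _ _) _.
suff : `|rip (x n - w) h| <= e / 2 by move: ha2; lra.
apply: le_trans (rip_le_hnorm _ _) _.
move: h1; rewrite ltr_pdivlMr // => h1.
apply: le_trans (ltW h1); rewrite ler_wpM2l ?hnorm_ge0 // /c; lra.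
Qed.

Lemma bop_rscale (L : bop V) u q : L (u *> q) = L u *> q.
Proof. by rewrite /rscale linearZ. Qed.

Lemma adjoint_pt (L : bop V) (v : V) :
  exists w, forall u, inner w u = inner v (L u).
Proof.
have [M LM] := bop_bounded L.
have [|||w wP] := @real_riesz (fun u => rip v (L u)) (hnorm v * M).
- by move=> x y; rewrite linearD ripDr.
- by move=> x t; rewrite bop_rscale ripZr.
- move=> x; apply: le_trans (rip_le_hnorm _ _) _.
  by rewrite -mulrA ler_wpM2l ?hnorm_ge0.
exists w => u; apply/eqP; rewrite -subr_eq0; apply/eqP/qre_eq0 => q.
rewrite mulrBl -!innerZr -bop_rscale.
by have := wP (u *> q); rewrite /rip /= => ->; rewrite subrr.
Qed.

Lemma adjoint_exists (L : bop V) :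
  exists M : bop V, forall u v, inner (M u) v = inner u (L v).
Proof.
have [M0 LM] := bop_bounded L.
have /choice[f fP] := adjoint_pt L.
have fL : linear f.
  move=> q u v; apply: inner_inj => w; rewrite fP !innerDl !fP.
  by congr (_ + _); rewrite inner_conj innerZr qconjM -inner_conj -fP
    [RHS]inner_conj innerZr qconjM -inner_conj.
pose fLin := GRing.isLinear.Build _ _ _ _ f fL.
pose F : {linear V -> V} := HB.pack f fLin.
have FM : exists M : R, forall u, hnorm (F u) <= M * hnorm u.
  exists `|M0| => u; have [e|fu0] := eqVneq (hnorm (F u)) 0.
    by rewrite e mulr_ge0 ?hnorm_ge0.
  have fu_gt0 : 0 < hnorm (F u) by rewrite lt_neqAle eq_sym fu0 hnorm_ge0.
  rewrite -(ler_pM2r fu_gt0) -expr2 hnorm_sqr /rip fP.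
  apply: le_trans (ler_norm _) _; apply: le_trans (rip_le_hnorm _ _) _.
  rewrite (mulrC `|M0|) -mulrA ler_wpM2l ?hnorm_ge0 //.
  by apply: le_trans (LM _) _; rewrite ler_wpM2r ?hnorm_ge0 // ler_norm.
by exists (BOp FM).
Qed.

(* L^*: the unique operator M with <M u, v> = <u, L v>, which exists by Riesz
   representation. *)
Definition adjoint (L : bop V) : bop V := projT1 (cid (adjoint_exists L)).

Lemma adjointE (L : bop V) u v : inner (adjoint L u) v = inner u (L v).
Proof. exact: (projT2 (cid (adjoint_exists L))). Qed.

End Adjoint.

Section DirectSum.
Variables (R : realType).

Section PreHilbert.
Variables V1 V2 : qprehilbertType R.
Local Notation S := (V1 * V2)%type.

(* The direct sum is carried by the product, and u (+) v is the pair (u, v). *)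
Definition dsum_inner (x y : S) : quat R :=
  inner x.1 y.1 + inner x.2 y.2.

Fact dsum_inner_conj x y : dsum_inner x y = qconj (dsum_inner y x).
Proof. by rewrite /dsum_inner qconjD -!inner_conj. Qed.

Lemma inner_self_real (V : qprehilbertType R) (u : V) :
  inner u u = qreal (qre (inner u u)).
Proof.
have [->|/inner_gt0[]//] := eqVneq u 0.
have : inner (0 : V) 0 = 0.
  by apply: (@addrI _ (inner (0 : V) 0)); rewrite -innerDr !addr0.
by move=> ->.
Qed.

Fact dsum_inner_gt0 x : x != 0 -> qpos (dsum_inner x x).
Proof.
case: x => u v; rewrite /dsum_inner /= => nz; split.
  rewrite (inner_self_real u) (inner_self_real v).
  by congr Quat => /=; rewrite addr0.
have u0 := rip_ge0 u; have v0 := rip_ge0 v.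
rewrite qreD -!/(rip _ _); have [ue|/rip_gt0 ?] := eqVneq u 0; last first.
  exact: ltr_wpDr.
have [ve|/rip_gt0 ?] := eqVneq v 0; last exact: ltr_wpDl.
by move: nz; rewrite ue ve eqxx.
Qed.

Fact dsum_innerDr x y z : dsum_inner x (y + z) = dsum_inner x y + dsum_inner x z.
Proof. by rewrite /dsum_inner !innerDr addrACA. Qed.

Fact dsum_innerZr x y (q : quat R) :
  dsum_inner x (y *> q) = dsum_inner x y * q.
Proof. by rewrite /dsum_inner mulrDl -!innerZr. Qed.

HB.instance Definition _ := @isQuatInner.Build R S dsum_inner
  dsum_inner_conj dsum_inner_gt0 dsum_innerDr dsum_innerZr.

Lemma dsum_hnorm_sqr (x : S) : hnorm x ^+ 2 = hnorm x.1 ^+ 2 + hnorm x.2 ^+ 2.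
Proof. by rewrite !hnorm_sqr. Qed.

Lemma dsum_hnorm1 (x : S) : hnorm x.1 <= hnorm x.
Proof.
rewrite -(@ler_pXn2r _ 2) ?nnegrE ?hnorm_ge0 // dsum_hnorm_sqr.
by rewrite lerDl sqr_ge0.
Qed.

Lemma dsum_hnorm2 (x : S) : hnorm x.2 <= hnorm x.
Proof.
rewrite -(@ler_pXn2r _ 2) ?nnegrE ?hnorm_ge0 // dsum_hnorm_sqr.
by rewrite lerDr sqr_ge0.
Qed.

Lemma dsum_hnormD (x : S) : hnorm x <= hnorm x.1 + hnorm x.2.
Proof.
rewrite -(@ler_pXn2r _ 2) ?nnegrE ?addr_ge0 ?hnorm_ge0 // dsum_hnorm_sqr.
by rewrite sqrrD addrAC lerDl mulrn_wge0 // mulr_ge0 ?hnorm_ge0.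
Qed.

End PreHilbert.

Section Hilbert.
Variables V1 V2 : qhilbertType R.
Local Notation S := (V1 * V2)%type.

Fact dsum_complete (x : nat -> S) :
  (forall e : R, 0 < e -> exists N : nat, forall m n : nat,
     (N <= m)%N -> (N <= n)%N -> hnorm (x m - x n) < e) ->
  exists l : S, hnorm (x n - l) @[n --> \oo] --> (0 : R).
Proof.
move=> xC.
have [|a ha] := @hcomplete R V1 (fun n => (x n).1).
  move=> e /xC[N hN]; exists N => m n Nm Nn.
  exact: le_lt_trans (dsum_hnorm1 (x m - x n)) (hN _ _ Nm Nn).
have [|b hb] := @hcomplete R V2 (fun n => (x n).2).
  move=> e /xC[N hN]; exists N => m n Nm Nn.
  exact: le_lt_trans (dsum_hnorm2 (x m - x n)) (hN _ _ Nm Nn).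
exists (a, b); have := cvgD ha hb; rewrite addr0.
move=> /(_ _) hab; apply: (squeeze_cvgr _ (cvg_cst 0) hab).
apply: nearW => n.
by rewrite hnorm_ge0 /=; apply: dsum_hnormD.
Qed.

HB.instance Definition _ := @isQuatComplete.Build R S dsum_complete.

Definition dsum_fun (K1 : V1 -> V1) (K2 : V2 -> V2) (x : S) : S :=
  (K1 x.1, K2 x.2).

Fact dsum_fun_linear (K1 : bop V1) (K2 : bop V2) : linear (dsum_fun K1 K2).
Proof. by move=> q x y; rewrite /dsum_fun /= !linearP. Qed.

HB.instance Definition _ (K1 : bop V1) (K2 : bop V2) :=
  GRing.isLinear.Build _ _ _ _ (dsum_fun K1 K2) (dsum_fun_linear K1 K2).

Fact dsum_fun_bounded (K1 : bop V1) (K2 : bop V2) :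
  exists M : R, forall x, hnorm (dsum_fun K1 K2 x) <= M * hnorm x.
Proof.
have [M1 h1] := bop_bounded K1; have [M2 h2] := bop_bounded K2.
exists (`|M1| + `|M2|) => x; apply: le_trans (dsum_hnormD _) _.
rewrite mulrDl lerD //=.
  apply: le_trans (h1 _) _; apply: le_trans (_ : `|M1| * hnorm x.1 <= _).
    by rewrite ler_wpM2r ?hnorm_ge0 ?ler_norm.
  by rewrite ler_wpM2l // dsum_hnorm1.
apply: le_trans (h2 _) _; apply: le_trans (_ : `|M2| * hnorm x.2 <= _).
  by rewrite ler_wpM2r ?hnorm_ge0 ?ler_norm.
by rewrite ler_wpM2l // dsum_hnorm2.
Qed.

Definition dsum_bop (K1 : bop V1) (K2 : bop V2) : bop S :=
  @BOp R S (dsum_fun K1 K2) (dsum_fun_bounded K1 K2).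

Lemma dsum_bopE (K1 : bop V1) (K2 : bop V2) u v :
  dsum_bop K1 K2 (u, v) = (K1 u, K2 v).
Proof. by []. Qed.

End Hilbert.
End DirectSum.

(* The sum is taken in [0, +oo], so the upper bound includes its convergence. *)
Definition is_Kframe (R : realType) (V : qhilbertType R) (I : countType)
    (K : bop V) (w : I -> V) : Prop :=
  exists A B : R, [/\ 0 < A, A <= B & forall u : V,
    ((A * hnorm (adjoint K u) ^+ 2)%:E
       <= \esum_(i in [set: I]) (qabs (inner (w i) u) ^+ 2)%:E)%E /\
    (\esum_(i in [set: I]) (qabs (inner (w i) u) ^+ 2)%:E
       <= (B * hnorm u ^+ 2)%:E)%E].

(* Main.v *)
Require Import Defs.
From HB Require Import structures.
From mathcomp Require Import all_boot all_order all_algebra.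
From mathcomp Require Import all_classical all_reals all_analysis.

(** Each summand sits isometrically inside the direct sum, by [x |-> (x, 0)] or
    [y |-> (0, y)].  Testing the frame inequalities of the direct sum on such
    vectors gives exactly those of the summand, with the same bounds [A] and
    [B]: the coefficient [<(u_i, v_i), (x, 0)>] is [<u_i, x>], and
    [(K1 (+) K2)^* (x, 0) = (K1^* x, 0)] since the adjoint of a direct sum acts
    componentwise ([adjoint_dsum_bop]).  Both summands are thus instances of
    the restriction principle [Kframe_restrict]. *)

Import GRing.Theory.
Local Open Scope ring_scope.

Lemma inner0r (R : realType) (V : qprehilbertType R) (x : V) :
  inner x 0 = 0.
Proof. by apply: (@addrI _ (inner x 0)); rewrite -innerDr !addr0. Qed.

Lemma dsum_innerE (R : realType) (V1 V2 : qprehilbertType R) (x y : V1 * V2) :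
  inner x y = inner x.1 y.1 + inner x.2 y.2.
Proof. by []. Qed.

Lemma hnorm_dsum0r (R : realType) (V1 V2 : qprehilbertType R) (x : V1) :
  hnorm ((x, 0) : V1 * V2) = hnorm x.
Proof. by rewrite /hnorm dsum_innerE /= inner0r addr0. Qed.

Lemma hnorm_dsum0l (R : realType) (V1 V2 : qprehilbertType R) (y : V2) :
  hnorm ((0, y) : V1 * V2) = hnorm y.
Proof. by rewrite /hnorm dsum_innerE /= inner0r add0r. Qed.

(** An adjoint is determined by its inner products, and those of the direct
    sum split into the two components. *)
Lemma adjoint_dsum_bop (R : realType) (V1 V2 : qhilbertType R)
    (K1 : bop V1) (K2 : bop V2) (x : V1) (y : V2) :
  adjoint (dsum_bop K1 K2) (x, y) = (adjoint K1 x, adjoint K2 y).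
Proof.
apply: inner_inj => -[a b]; rewrite adjointE dsum_bopE.
by rewrite !dsum_innerE /= !adjointE.
Qed.

(** Every term of the frame inequalities for [L] at [J x] equals the matching
    term for [K] at [x], so the bounds carry over.  When [J] is the inclusion of
    a summand, the condition on inner products makes [w' i] the image of [w i]
    under the adjoint of [J]; put this way it avoids introducing adjoints of
    maps between two different spaces. *)
Lemma Kframe_restrict (R : realType) (V W : qhilbertType R) (I : countType)
    (K : bop V) (L : bop W) (J : V -> W) (w : I -> W) (w' : I -> V) :
  (forall i x, inner (w i) (J x) = inner (w' i) x) ->
  (forall x, hnorm (J x) = hnorm x) ->
  (forall x, hnorm (adjoint L (J x)) = hnorm (adjoint K x)) ->
  is_Kframe L w -> is_Kframe K w'.
Proof.
move=> wJ normJ adjJ [A [B [A0 AB frame]]]; exists A, B; split=> // x.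
have [] := frame (J x); rewrite normJ adjJ.
by under eq_esum do rewrite wJ.
Qed.

Theorem corollary2 (R : realType) (H1 H2 : qhilbertType R) (I : countType)
    (K1 : bop H1) (K2 : bop H2) (u : I -> H1) (v : I -> H2) :
  is_Kframe (dsum_bop K1 K2) (fun i : I => (u i, v i)) ->
  is_Kframe K1 u /\ is_Kframe K2 v.
Proof.
move=> frame; split.
- apply: (@Kframe_restrict R H1 _ I K1 _ (fun x => (x, 0)) _ u _ _ _ frame).
  + by move=> i x; rewrite dsum_innerE /= inner0r addr0.
  + by move=> x; apply: hnorm_dsum0r.
  + by move=> x; rewrite adjoint_dsum_bop linear0 hnorm_dsum0r.
- apply: (@Kframe_restrict R H2 _ I K2 _ (fun y => (0, y)) _ v _ _ _ frame).
  + by move=> i y; rewrite dsum_innerE /= inner0r add0r.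
  + by move=> y; apply: hnorm_dsum0l.
  + by move=> y; rewrite adjoint_dsum_bop linear0 hnorm_dsum0l.
Qed.
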